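(* Let $\mathcal{P} \subset \mathbb{R}^N$ be an integral simplex of dimension $d$ and $\delta(\mathcal{P})=(\delta_0,\delta_1,\ldots,\delta_d)$ its $\delta$-vector. Suppose that the normalized volume $\sum_{i=0}^d \delta_i=p$ is an odd prime number. Let $i_1,\ldots,i_{p-1}$ be the positive integers such that $\sum_{i=0}^d\delta_i t^i=1+t^{i_1}+\cdots+t^{i_{p-1}}$ with $1 \leq i_1 \leq \cdots \leq i_{p-1} \leq d$. Then: (a) $i_1+i_{p-1}=i_2+i_{p-2}=\cdots=i_{(p-1)/2}+i_{(p+1)/2} \leq d+1$; (b) $i_k+i_{\ell} \geq i_{k+\ell}$ for all integers $k,\ell$ with $1 \leq k \leq \ell \leq p-1$ and $k+\ell \leq p-1$.
   Context: An integral convex polytope $\mathcal{P}\subset\mathbb{R}^N$ is a convex polytope all of whose vertices have integer coordinates; an integral simplex of dimension $d$ is an integral convex polytope that is a $d$-dimensional simplex. For an integral convex polytope $\mathcal{P}$ of dimension $d$ and an integer $n\ge 1$, let $i(\mathcal{P},n)=|n\mathcal{P}\cap\mathbb{Z}^N|$, where $n\mathcal{P}=\{n\alpha:\alpha\in\mathcal{P}\}$, and $i(\mathcal{P},0)=1$; this is a polynomial in $n$ of degree $d$ (the Ehrhart polynomial). The $\delta$-vector $\delta(\mathcal{P})=(\delta_0,\delta_1,\ldots,\delta_d)$ is the integer sequence defined by $(1-\lambda)^{d+1}\sum_{n=0}^\infty i(\mathcal{P},n)\lambda^n=\sum_{i=0}^d\delta_i\lambda^i$ (it is known that the left side is a polynomial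 of degree at most $d$, that all $\delta_i$ are nonnegative integers, and that $\delta_0=1$). The normalized volume of $\mathcal{P}$ is $\sum_{i=0}^d\delta_i$. *)

(* Defs.v *)
From HB Require Import structures.
From mathcomp Require Import all_boot all_order all_algebra.
From mathcomp Require Import finmap.
From mathcomp Require Import all_classical all_reals.

Set Implicit Arguments.
Unset Strict Implicit.
Unset Printing Implicit Defensive.

Import Order.TTheory GRing.Theory Num.Theory.

Local Open Scope classical_set_scope.
Local Open Scope ring_scope.

Definition convex_hull (R : realType) (N m : nat) (v : 'I_m -> 'rV[R]_N) :
    set 'rV[R]_N :=
  [set x | exists a : 'I_m -> R,
     [/\ forall i, 0 <= a i, \sum_i a i = 1 & x = \sum_i a i *: v i]].

Definition affinely_independent (R : realType) (N m : nat)
    (v : 'I_m -> 'rV[R]_N) : Prop :=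
  forall a : 'I_m -> R,
    \sum_i a i = 0 -> \sum_i a i *: v i = 0 -> forall i, a i = 0.

Definition convex_polytope (R : realType) (N : nat) (P : set 'rV[R]_N) : Prop :=
  exists (m : nat) (v : 'I_m -> 'rV[R]_N), P = convex_hull v.

(* The vertices of a convex polytope are its extreme points. *)
Definition vertex (R : realType) (N : nat) (P : set 'rV[R]_N) (x : 'rV[R]_N) :
    Prop :=
  P x /\ forall (y z : 'rV[R]_N) (t : R),
    P y -> P z -> 0 < t < 1 -> x = (1 - t) *: y + t *: z -> y = z.

Definition integer_points (R : realType) (N : nat) : set 'rV[R]_N :=
  [set x | x \is a mxOver Num.int].

Definition integral_polytope (R : realType) (N : nat) (P : set 'rV[R]_N) :
    Prop :=
  convex_polytope P /\ vertex P `<=` @integer_points R N.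

Definition simplex (R : realType) (N d : nat) (P : set 'rV[R]_N) : Prop :=
  exists v : 'I_d.+1 -> 'rV[R]_N, affinely_independent v /\ P = convex_hull v.

Definition integral_simplex (R : realType) (N d : nat) (P : set 'rV[R]_N) :
    Prop :=
  integral_polytope P /\ simplex d P.

Definition dilate (R : realType) (N n : nat) (P : set 'rV[R]_N) :
    set 'rV[R]_N :=
  [set n%:R *: x | x in P].

(* [fset_set] sends infinite sets to [fset0]; the sets counted here are finite
   because a polytope is bounded. *)
Definition ehrhart (R : realType) (N : nat) (P : set 'rV[R]_N) (n : nat) : nat :=
  if n == 0%N then 1%N
  else #|` fset_set (dilate n P `&` @integer_points R N)|.

(* Product of the formal power series with coefficients [a] and [b]. *)
Definition series_mul (a b : nat -> int) (n : nat) : int :=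
  \sum_(k < n.+1) a k * b (n - k)%N.

(* [delta d P j] is the coefficient of lambda^j in
   (1 - lambda)^(d+1) * \sum_n (ehrhart P n) lambda^n.  The delta-vector of a
   [d]-dimensional [P] consists of the entries with [j <= d]; the remaining
   coefficients of this series are known to vanish. *)
Definition delta (R : realType) (N d : nat) (P : set 'rV[R]_N) : nat -> int :=
  series_mul (fun k => ((1 - 'X : {poly int}) ^+ d.+1)`_k)
             (fun n => (ehrhart P n)%:Z).

Definition delta_poly (R : realType) (N d : nat) (P : set 'rV[R]_N) :
    {poly int} :=
  \sum_(j < d.+1) delta d P j *: 'X^j.

Definition normalized_volume (R : realType) (N d : nat) (P : set 'rV[R]_N) :
    int :=
  \sum_(j < d.+1) delta d P j.

(* Main.v *)
Require Import Defs.
From HB Require Import structures.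
From mathcomp Require Import all_boot all_order all_algebra.
From mathcomp Require Import fingroup cyclic.
From mathcomp Require Import finmap.
From mathcomp Require Import all_classical all_reals.
From mathcomp Require Import fintype finset zify ring.

(** The delta-vector of an integral simplex with vertices [v_0, ..., v_d]
counts the points of a finite abelian group by height.  Let the box be the set
of vectors [c] in [0, 1)^(d+1) such that [sum_i c_i] is an integer and
[sum_i c_i v_i] is an integer point.  Under addition modulo 1 it is a group,
and the height [sum_i c_i] is an integer-valued function on it.

A lattice point of the [n]-th dilate has unique coordinates [c_i >= 0] with sum
[n]; splitting each [c_i] into its integral and fractional parts turns the
point into a box element [x] together with a vector of natural numbers of sum
[n - height x] ([dilate_points]).  So the Ehrhart series is
[sum_x t^(height x) / (1 - t)^(d+1)], and the delta-polynomial is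
[sum_x t^(height x)] ([delta_poly_height]).  In particular the normalized
volume is the order of the box group, here a prime [p], and
[i_1 <= ... <= i_(p-1)] are the heights of the nonzero elements in increasing
order; equivalently [i_k <= j] exactly when more than [k] elements have height
at most [j] ([sorted_rank]).

For (a): the coordinates of [x] and [-x] add up to 1 where [x_i] is nonzero and
to 0 elsewhere, so [height x + height (-x)] is the size of the support of [x].
For each [i] the elements with vanishing [i]-th coordinate form a subgroup,
which is trivial or everything because [p] is prime; hence all nonzero elements
have the same support, of some size [s <= d + 1].  Inversion thus reflects the
list of heights, and [i_k + i_(p-k) = s] ([ranked_reflect]).

For (b): height is subadditive, so the sum of the sets of elements of height at
most [i_k] and at most [i_l], which have at least [k+1] and [l+1] elements,
lies in the set of elements of height at most [i_k + i_l].  By the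
Cauchy-Davenport theorem the latter has at least [k+l+1] elements, that is,
[i_(k+l) <= i_k + i_l] ([ranked_subadditive]). *)

Set Implicit Arguments.
Unset Strict Implicit.
Unset Printing Implicit Defensive.

Import Order.TTheory GRing.Theory Num.Theory.

(** * The Cauchy-Davenport theorem in groups of prime order *)

Local Open Scope group_scope.

Lemma prime_group_full (gT : finGroupType) (G : {group gT}) (x : gT) :
  prime #|gT| -> x != 1 -> x \in G -> G = setT :> {set gT}.
Proof.
move=> /primeP[_ dvd_gT] x1 Gx; apply/eqP; rewrite eqEcard subsetT /=.
have := cardSg (subsetT G); rewrite cardsT => /dvd_gT/orP[|/eqP-> //].
rewrite -trivg_card1 => /eqP G1.
by move: Gx x1; rewrite G1 inE => ->.
Qed.

Lemma prime_stable_set (gT : finGroupType) (A : {set gT}) (b : gT) :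
    prime #|gT| -> A != set0 -> b != 1 ->
    {in A, forall a, a * b \in A} ->
  A = setT.
Proof.
move=> pr /set0Pn[a Aa] b1 Ab; apply/setP=> x; rewrite inE.
have : a^-1 * x \in <[b]> by rewrite (prime_group_full pr b1 (cycle_id b)) inE.
case/cycleP=> k /(canRL (mulKg _)); rewrite invgK => ->.
by elim: k => [|k IHk]; rewrite ?mulg1 // expgSr mulgA Ab.
Qed.

(** Induction on [#|B|] by the Dyson transform: replacing [A] and [B] by
[A :|: e *: B] and [B :&: e^-1 *: A] with [e] in [A] keeps the sum of the
cardinals and does not enlarge the product set.  It makes [B] strictly smaller
unless [e *: B] is contained in [A]; if that happens for all [e], then [A] is
stable under [B], so either [B] is trivial or [A] is the whole group. *)
Lemma Cauchy_Davenport (gT : finGroupType) (A B : {set gT}) :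
    prime #|gT| -> A != set0 -> 1 \in B ->
  minn #|gT| (#|A| + #|B|).-1 <= #|A * B|.
Proof.
move=> pr; have [n] := ubnP #|B|; elim: n A B => // n IHn A B leBn A0 B1.
have cGT (x y : gT) : x * y = y * x.
  suff /centsP cTT : abelian [set: gT] by apply: cTT; rewrite inE.
  by apply/cyclic_abelian/prime_cyclic; rewrite cardsT.
have [|] := boolP [exists e in A, ~~ (e *: B \subset A)]; last first.
  rewrite negb_exists_in => /forall_inP stabA.
  have leA : #|A| <= #|A * B| by rewrite subset_leq_card // mulg_subl.
  have [B11 | [b Bb b1]] : B \subset [set 1] \/ exists2 b, b \in B & b != 1.
  - have [|/subsetPn[b Bb]] := boolP (B \subset [set 1]); first by left.
    by rewrite inE => b1; right; exists b.
  - have := subset_leq_card B11; rewrite cards1 => leB1.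
    apply: leq_trans (geq_minr _ _) (leq_trans _ leA).
    by move: #|A| #|B| leB1 => a c; lia.
  - suff eA : A = setT.
      apply: leq_trans (geq_minl _ _) (leq_trans _ leA).
      by rewrite eA cardsT.
    apply: (@prime_stable_set _ A b) => // a Aa.
    have := stabA a Aa; rewrite negbK => /subsetP; apply.
    by rewrite mem_lcoset mulKg.
case/exists_inP=> e Ae NeBA.
set A' := A :|: e *: B; set B' := B :&: e^-1 *: A.
have B'1 : 1 \in B' by rewrite inE B1 mem_lcoset invgK mulg1.
have sum : #|A'| + #|B'| = #|A| + #|B|.
  have -> : #|B'| = #|A :&: e *: B|.
    rewrite -(card_lcoset B' e); apply: eq_card => x.
    by rewrite mem_lcoset !inE !mem_lcoset invgK mulKVg andbC.
  by rewrite cardsUI card_lcoset.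
have ltB'B : #|B'| < #|B|.
  apply: proper_card; rewrite properE subsetIl /=.
  apply: contra NeBA => /subsetP sBB'; apply/subsetP=> x.
  rewrite mem_lcoset => /sBB'; rewrite inE => /andP[_].
  by rewrite mem_lcoset invgK mulKVg.
have sAB : A' * B' \subset A * B.
  apply/subsetP=> _ /mulsgP[x y + + ->]; rewrite !inE !mem_lcoset invgK.
  case/orP=> [Ax|Bx] /andP[By Ay]; first exact: mem_mulg.
  have -> : x * y = (e * y) * (e^-1 * x).
    by rewrite [e * y]cGT -mulgA mulKVg cGT.
  exact: mem_mulg.
have A'0 : A' != set0 by apply/set0Pn; exists e; rewrite inE Ae.
have := IHn A' B' (leq_trans ltB'B leBn) A'0 B'1; rewrite sum => le1.
exact: leq_trans le1 (subset_leq_card sAB).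
Qed.

(** * Sorted values of a height function *)

Definition sublevel (T : finType) (ht : T -> nat) (j : nat) : {set T} :=
  [set x | ht x <= j].

(** With [N j] the number of elements of height at most [j], this says that
[i_1 <= i_2 <= ...] lists the heights of the nonzero elements in order: entry
[k] is at most [j] when at least [k] nonzero elements, plus the zero element,
have height at most [j]. *)
Lemma sorted_rank (p : nat) (i N : nat -> nat) :
    (forall k l, 1 <= k -> k <= l -> l <= p - 1 -> i k <= i l) ->
    (forall j, N j = 1 + \sum_(1 <= k < p) (i k <= j)) ->
  forall k j, 1 <= k < p -> (i k <= j) = (k < N j).
Proof.
move=> i_mono NE k j /andP[k1 kp]; rewrite NE.
rewrite (@big_cat_nat _ _ _ k) //=; last exact: ltnW.
have lek : \sum_(1 <= m < k) (i m <= j) <= k - 1.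
  by rewrite -[k - 1]muln1 -sum_nat_const_nat leq_sum // => m _; apply: leq_b1.
have [ikj | jik] := leqP (i k) j.
  have -> : \sum_(1 <= m < k) (i m <= j) = k - 1.
    rewrite -[RHS]muln1 -sum_nat_const_nat; apply: eq_big_nat => m /andP[m1 mk].
    by rewrite (leq_trans _ ikj) // i_mono; lia.
  by rewrite big_ltn // ikj; lia.
rewrite [X in _ + (_ + X)]big_nat_cond [X in _ + (_ + X)]big1 => [|m].
  by apply/esym; lia.
case/andP=> /andP[km mp] _.
apply/eqP; rewrite eqb0 -ltnNge (leq_trans jik) // i_mono; lia.
Qed.

(** Summing the coefficients of index at most [j] turns ['X^n] into the truth
value of [n <= j]; apply this to both sides. *)
Lemma card_sublevel (T : finType) (ht : T -> nat) (p : nat) (i : nat -> nat) :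
    (\sum_x 'X^(ht x) = 1 + \sum_(1 <= k < p) 'X^(i k) :> {poly int})%R ->
  forall j, #|sublevel ht j| = 1 + \sum_(1 <= k < p) (i k <= j).
Proof.
move=> eqp j.
pose S (q : {poly int}) : int := (\sum_(m < j.+1) q`_m)%R.
have SX n : S 'X^n%R = (n <= j)%:R%R.
  rewrite /S; under eq_bigr do rewrite coefXn; have [nj|jn] := leqP n j.
    rewrite (bigD1 (Ordinal (nj : n < j.+1))) //= eqxx big1 ?addr0 // => m.
    by rewrite -val_eqE /= => /negPf->.
  rewrite big1 // => m _; case: eqP (ltn_ord m) => // ->.
  by rewrite ltnS leqNgt jn.
have SD q r : S (q + r)%R = (S q + S r)%R.
  by rewrite /S -big_split; apply: eq_bigr => m _; rewrite coefD.
have S0 : S 0%R = 0%R by rewrite /S big1 // => m _; rewrite coef0.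
have SsumX I r (f : I -> nat) :
    S (\sum_(x <- r) 'X^(f x))%R = (\sum_(x <- r) (f x <= j))%:R%R.
  rewrite (big_morph S SD S0) natr_sum; apply: eq_bigr => x _.
  exact: SX.
have := congr1 S eqp; rewrite SD !SsumX -(expr0 'X%R) SX.
rewrite -natrD => /eqP; rewrite eqr_nat => /eqP <-.
by rewrite -sum1_card big_mkcond; apply: eq_bigr => x _; rewrite inE; case: leqP.
Qed.

(** The product of the sublevel sets at [i k] and [i l] lies in the sublevel set
at [i k + i l]; Cauchy-Davenport gives it more than [k + l] elements. *)
Lemma ranked_subadditive (gT : finGroupType) (ht : gT -> nat) (i : nat -> nat) :
    prime #|gT| -> ht 1 = 0 ->
    (forall x y : gT, ht (x * y) <= ht x + ht y) ->
    (forall k j, 1 <= k < #|gT| -> (i k <= j) = (k < #|sublevel ht j|)) ->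
  forall k l, 1 <= k -> 1 <= l -> k + l < #|gT| -> i (k + l) <= i k + i l.
Proof.
move=> pr_gT ht1 htM iE k l k1 l1 klp; rewrite iE; last by lia.
have := iE k (i k); rewrite leqnn => /(_ ltac:(lia))/esym Nk.
have := iE l (i l); rewrite leqnn => /(_ ltac:(lia))/esym Nl.
have A1 j : 1 \in sublevel ht j by rewrite inE ht1.
have sk0 : sublevel ht (i k) != set0 by apply/set0Pn; exists 1.
have CD := Cauchy_Davenport pr_gT sk0 (A1 (i l)).
have sS : sublevel ht (i k) * sublevel ht (i l) \subset sublevel ht (i k + i l).
  apply/subsetP=> _ /mulsgP[x y + + ->]; rewrite !inE => xk yl.
  exact: leq_trans (htM x y) (leq_add xk yl).
apply: leq_trans (subset_leq_card sS); apply: leq_trans CD; rewrite leq_min klp.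
by move: #|sublevel ht (i k)| Nk #|sublevel ht (i l)| Nl => a ? b ?; lia.
Qed.

(** Inversion exchanges the nontrivial elements of height at most [s - 1 - j]
with those of height greater than [j]; the identity is counted twice. *)
Lemma card_sublevel_reflect (gT : finGroupType) (ht : gT -> nat) (s j : nat) :
    ht 1 = 0 -> (forall x : gT, x != 1 -> ht x + ht x^-1 = s) -> j < s ->
  #|sublevel ht j| + #|sublevel ht (s - 1 - j)| = #|gT|.+1.
Proof.
move=> ht1 htV js.
have N1 m : #|sublevel ht m| = (#|[set x | (x != 1) && (ht x <= m)]|).+1.
  rewrite (cardsD1 1 (sublevel ht m)) inE ht1 leq0n add1n; congr _.+1.
  by apply: eq_card => x; rewrite !inE.
rewrite !N1 addSn addnS; congr _.+1.
have -> : #|[set x | (x != 1) && (ht x <= s - 1 - j)]|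
        = #|[set x | (x != 1) && (j < ht x)]|.
  rewrite -[RHS](card_imset _ (@invg_inj gT)); apply: eq_card => x.
  apply/idP/imsetP => [|[y + ->]]; rewrite !inE => /andP[x1 hx].
    exists x^-1; rewrite ?invgK // inE invg_eq1 x1 /=.
    by have := htV _ x1; move: (ht x) (ht x^-1) hx => a b; lia.
  rewrite invg_eq1 x1 /=.
  by have := htV _ x1; move: (ht y) (ht y^-1) hx => a b; lia.
rewrite -cardsT [in RHS](cardsD1 1) inE add1n; congr _.+1.
rewrite -cardsUI; set X := _ :&: _; have -> : X = set0.
  by apply/setP=> x; rewrite !inE; case: eqP => //= _; lia.
rewrite cards0 addn0; apply: eq_card => x; rewrite !inE andbT.
by case: eqP => //= _; lia.
Qed.

Lemma ranked_reflect (gT : finGroupType) (ht : gT -> nat) (s : nat)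
    (i : nat -> nat) :
    ht 1 = 0 -> (forall x : gT, x != 1 -> ht x + ht x^-1 = s) ->
    (forall k j, 1 <= k < #|gT| -> (i k <= j) = (k < #|sublevel ht j|)) ->
  forall k, 1 <= k < #|gT| -> i k + i (#|gT| - k) = s.
Proof.
move=> ht1 htV iE k kp; have kp' : 1 <= #|gT| - k < #|gT| by lia.
have i_le_s m : 1 <= m < #|gT| -> i m <= s.
  move=> mp; rewrite iE //; have -> : #|sublevel ht s| = #|gT|; last by lia.
  rewrite -cardsT; apply: eq_card => x; rewrite !inE.
  by have [->|/htV <-] := eqVneq x 1; rewrite ?ht1 ?leq_addr.
have iks := i_le_s k kp; have iks' := i_le_s _ kp'.
have kN : k < #|sublevel ht (i k)| by rewrite -iE.
have Nk : 0 < i k -> #|sublevel ht (i k).-1| <= k.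
  by move=> ik0; rewrite leqNgt -iE // -ltnNge ltn_predL.
(* Each inequality is the reflection identity at a level next to [i k]:
   below [i k] there are at most [k] elements, up to [i k] more than [k]. *)
apply/eqP; rewrite eqn_leq; apply/andP; split.
  have [ik0|ik0] := posnP (i k); first by rewrite ik0.
  suff : i (#|gT| - k) <= s - i k by lia.
  have := card_sublevel_reflect (j := (i k).-1) ht1 htV ltac:(lia).
  have -> : s - 1 - (i k).-1 = s - i k by lia.
  by rewrite iE // => NN; have := Nk ik0; lia.
have [|iks1] := leqP s (i k); first by lia.
suff : ~~ (i (#|gT| - k) <= s - 1 - i k) by rewrite -ltnNge; lia.
by rewrite iE // -leqNgt; have := card_sublevel_reflect ht1 htV iks1; lia.
Qed.

Local Close Scope group_scope.
Local Open Scope ring_scope.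

(** * Fractional parts *)

Definition frac (R : realType) (x : R) : R := x - (Num.floor x)%:~R.

Lemma frac_itv (R : realType) (x : R) : 0 <= frac x < 1.
Proof. by rewrite subr_ge0 ltrBlDl -intrD1 floor_le floorD1_gt. Qed.

Lemma frac_eq (R : realType) (x y : R) :
  0 <= y < 1 -> x - y \is a Num.int -> frac x = y.
Proof.
move=> /andP[y0 y1] /intrP[k /eqP]; rewrite subr_eq => /eqP ->.
rewrite /frac (@floor_def _ _ k); last by rewrite intrD1 lerDl ltrD2l y0.
by rewrite addrAC subrr add0r.
Qed.

Lemma frac0 (R : realType) : frac 0 = 0 :> R.
Proof. by apply: frac_eq; rewrite ?lexx ?ltr01 // subrr rpred0. Qed.

Lemma frac_int (R : realType) (x : R) : x - frac x \is a Num.int.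
Proof. by rewrite opprB addrCA subrr addr0 intr_int. Qed.

Lemma fracDl (R : realType) (x y : R) : frac (frac x + y) = frac (x + y).
Proof.
apply: frac_eq; first exact: frac_itv.
have -> : frac x + y - frac (x + y) = (x + y - frac (x + y)) - (x - frac x).
  by move: (frac x) (frac (x + y)) => a b; ring.
by rewrite rpredB ?frac_int.
Qed.

Lemma frac_le (R : realType) (x : R) : 0 <= x -> frac x <= x.
Proof. by move=> x0; rewrite gerBl ler0z floor_ge0. Qed.

Lemma fracN (R : realType) (x : R) :
  0 <= x < 1 -> x + frac (- x) = (x != 0)%:R.
Proof.
move=> /andP[x0 x1]; have [->|xn0] := eqVneq x 0.
  by rewrite oppr0 frac0 addr0.
rewrite (@frac_eq _ _ (1 - x)); first by rewrite addrC subrK.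
  by rewrite subr_ge0 ltW //= gtrBl lt0r xn0.
by rewrite opprB addKr rpredN rpred1.
Qed.

Lemma frac_truncn (R : realType) (x : R) :
  0 <= x -> frac x + (Num.truncn x)%:R = x.
Proof.
move=> x0; rewrite truncn_floor x0 pmulrn gez0_abs ?floor_ge0 //.
by rewrite /frac subrK.
Qed.

Definition fracmx (R : realType) (m : nat) (c : 'rV[R]_m) : 'rV[R]_m :=
  map_mx (@frac R) c.

Lemma fracmx0 (R : realType) (m : nat) : fracmx (0 : 'rV[R]_m) = 0.
Proof. by apply/rowP=> j; rewrite !mxE frac0. Qed.

Lemma fracmxDl (R : realType) (m : nat) (c e : 'rV[R]_m) :
  fracmx (fracmx c + e) = fracmx (c + e).
Proof. by apply/rowP=> j; rewrite !mxE fracDl. Qed.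

(** * The box of a family of points *)

Lemma int_mxB (R : realType) (m n : nat) (A B : 'M[R]_(m, n)) :
  A \is a mxOver Num.int -> B \is a mxOver Num.int ->
  A - B \is a mxOver Num.int.
Proof.
move=> /mxOverP Aint /mxOverP Bint; apply/mxOverP=> i j.
by rewrite !mxE rpredB.
Qed.

(** The rows of [V] are the points of the family, so [c *m V] is their
combination with coefficients [c]. *)
Definition barycentric_lattice (R : realType) (m N : nat) (V : 'M[R]_(m, N)) :
    set 'rV[R]_m :=
  [set c : 'rV[R]_m |
     \sum_i c 0 i \is a Num.int /\ c *m V \is a mxOver Num.int].

Definition affinely_free (R : realType) (m N : nat) (V : 'M[R]_(m, N)) : Prop :=
  forall c : 'rV[R]_m, \sum_i c 0 i = 0 -> c *m V = 0 -> c = 0.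

Definition box (R : realType) (m N : nat) (V : 'M[R]_(m, N)) : set 'rV[R]_m :=
  [set c : 'rV[R]_m | barycentric_lattice V c /\ forall i, 0 <= c 0 i < 1].

Lemma barycentric_lattice0 (R : realType) (m N : nat) (V : 'M[R]_(m, N)) :
  barycentric_lattice V 0.
Proof.
split; last by rewrite mul0mx mxOver0.
by rewrite big1 // => i _; rewrite mxE.
Qed.

Lemma barycentric_latticeB (R : realType) (m N : nat) (V : 'M[R]_(m, N)) c e :
  barycentric_lattice V c -> barycentric_lattice V e ->
  barycentric_lattice V (c - e).
Proof.
move=> [cs cV] [es eV]; split; last by rewrite mulmxBl int_mxB.
by under eq_bigr do rewrite mxE [(- e) _ _]mxE; rewrite sumrB rpredB.
Qed.

Lemma box_fracmx (R : realType) (m N : nat) (V : 'M[R]_(m, N)) c :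
  V \is a mxOver Num.int -> barycentric_lattice V c -> box V (fracmx c).
Proof.
move=> Vint [cs cV]; split; last by move=> i; rewrite mxE frac_itv.
split.
  have -> : \sum_i fracmx c 0 i = \sum_i c 0 i - \sum_i (c 0 i - fracmx c 0 i).
    by rewrite sumrB opprB addrC subrK.
  by rewrite rpredB // rpred_sum // => i _; rewrite mxE frac_int.
have -> : fracmx c *m V = c *m V - (c - fracmx c) *m V.
  by rewrite -mulmxBl opprB addrC subrK.
rewrite int_mxB // mxOverM //; apply/mxOverP=> a i.
by rewrite !mxE frac_int.
Qed.

Lemma finite_bounded_int (R : realType) (n : nat) (b : nat) :
  finite_set [set y : 'rV[R]_n | y \is a mxOver Num.int /\
                                 forall j, `|y 0 j| <= b%:R].
Proof.
(* An integer of absolute value at most [b] is [k - b] with [0 <= k <= 2b]. *)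
pose f (z : {ffun 'I_n -> 'I_(b + b).+1}) : 'rV[R]_n :=
  \row_j ((z j)%:R - b%:R).
apply: (@sub_finite_set _ _
  [set f z | z in [set: {ffun 'I_n -> 'I_(b + b).+1}]]%classic); last first.
  by apply: finite_image; apply: finite_finset.
move=> y [/mxOverP yint yb].
have yE j : exists k : 'I_(b + b).+1, y 0 j = k%:R - b%:R.
  have : y 0 j + b%:R \is a Num.nat.
    rewrite natrEint rpredD ?yint ?natr_int //=.
    by rewrite -[b%:R]opprK subr_ge0; have := yb j; rewrite ler_norml => /andP[].
  case/natrP=> k yk; have kb : (k < (b + b).+1)%N.
    rewrite ltnS -(ler_nat R) -yk natrD lerD2r.
    by have := yb j; rewrite ler_norml => /andP[].
  by exists (Ordinal kb); rewrite /= -yk addrK.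
have [z zE] := boolp.choice yE.
by exists [ffun j => z j] => //; apply/rowP=> j; rewrite mxE ffunE zE.
Qed.

(** The homogenized family [(1 | V)] has independent rows, so [c] can be
recovered from [c *m (1 | V)], which is a bounded integer vector for [c] in the
box. *)
Lemma finite_box (R : realType) (m N : nat) (V : 'M[R]_(m, N)) :
  affinely_free V -> finite_set (box V).
Proof.
move=> Vfree; pose W : 'M[R]_(m, 1 + N) := row_mx (const_mx 1) V.
have WE (c : 'rV[R]_m) : c *m W = row_mx (\sum_i c 0 i)%:M (c *m V).
  suff sumE : c *m (const_mx 1 : 'cV[R]_m) = (\sum_i c 0 i)%:M.
    by rewrite mul_mx_row sumE.
  apply/rowP=> j; rewrite (ord1 j) !mxE eqxx mulr1n; apply: eq_bigr => i _.
  by rewrite mxE mulr1.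
have Wfree : row_free W.
  apply: inj_row_free => c; rewrite WE -row_mx0 => /eq_row_mx[c1 cV].
  apply: Vfree => //; have /matrixP/(_ 0 0) := c1; rewrite !mxE eqxx mulr1n.
  by move=> ->.
pose b := Num.bound (\sum_i \sum_j `|W i j|).
apply: (@sub_finite_set _ _ [set y *m pinvmx W | y in
  [set y : 'rV[R]_(1 + N) | y \is a mxOver Num.int /\
                            forall j, `|y 0 j| <= b%:R]]%classic).
  move=> c [[cs cV] c01]; exists (c *m W); last first.
    by rewrite -mulmxA mulmxVp // mulmx1.
  split.
    rewrite WE; apply/mxOverP=> i j; rewrite mxE; case: splitP => k _.
      by rewrite mxE !ord1 mulr1n.
    by move/mxOverP: cV; apply.
  move=> j; apply: (@le_trans _ _ (\sum_i \sum_j `|W i j|)); last first.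
    rewrite ltW // archi_boundP //.
    by apply: sumr_ge0 => i _; apply: sumr_ge0.
  rewrite mxE; apply: le_trans (ler_norm_sum _ _ _) _; apply: ler_sum => i _.
  rewrite (bigD1 j) //= -[X in X <= _]addr0 lerD ?sumr_ge0 // normrM.
  by have /andP[c0 c1] := c01 i; rewrite (ger0_norm c0) ler_piMl // ltW.
exact/finite_image/finite_bounded_int.
Qed.

(** The box as a finite type; this is faithful by [finite_box], since
[fset_set] sends infinite sets to the empty one. *)
Definition box_fset (R : realType) (m N : nat) (V : 'M[R]_(m, N)) :
    {fset 'rV[R]_m} :=
  fset_set (box V).

Lemma box_fsetP (R : realType) (m N : nat) (V : 'M[R]_(m, N))
    (x : box_fset V) :
  affinely_free V -> box V (val x).
Proof.
move=> Vfree; have := fsvalP x; rewrite in_fset_set; last exact: finite_box.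
exact: set_mem.
Qed.

Lemma fracmx_in_box (R : realType) (m N : nat) (V : 'M[R]_(m, N)) c :
    V \is a mxOver Num.int -> affinely_free V -> barycentric_lattice V c ->
  fracmx c \in box_fset V.
Proof.
move=> Vint Vfree cL; rewrite in_fset_set; last exact: finite_box.
exact/mem_set/box_fracmx.
Qed.

Lemma box_ge0 (R : realType) (m N : nat) (V : 'M[R]_(m, N)) (x : box_fset V) :
  affinely_free V -> forall i, 0 <= val x 0 i.
Proof. by move=> Vfree i; have [_ /(_ i)/andP[]] := box_fsetP x Vfree. Qed.

Definition height (R : realType) (m N : nat) (V : 'M[R]_(m, N))
    (x : box_fset V) : nat :=
  Num.truncn (\sum_i val x 0 i).

Lemma heightE (R : realType) (m N : nat) (V : 'M[R]_(m, N)) (x : box_fset V) :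
  affinely_free V -> (height x)%:R = \sum_i val x 0 i.
Proof.
move=> Vfree; have [[xs _] _] := box_fsetP x Vfree.
by rewrite /height truncnK // natrEint xs sumr_ge0 // => i _; apply: box_ge0.
Qed.

Lemma height_lt (R : realType) (m N : nat) (V : 'M[R]_(m.+1, N))
    (x : box_fset V) :
  affinely_free V -> (height x < m.+1)%N.
Proof.
move=> Vfree; rewrite -(ltr_nat R) heightE //.
rewrite -[X in _ < X%:R]card_ord -sum1_card natr_sum.
have [_ x01] := box_fsetP x Vfree.
apply: ltr_sum => [|i _]; last by have /andP[] := x01 i.
by apply/hasP; exists ord0; rewrite ?mem_index_enum.
Qed.

(** * The group structure of the box *)

(** [insubd] keeps the operations free of proof arguments.  When [V] is integral
and affinely free the box is closed under them ([val_box_mul], [val_box_inv]),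
so that its default value is never returned. *)
Definition box_mul (R : realType) (m N : nat) (V : 'M[R]_(m, N))
    (x y : box_fset V) : box_fset V :=
  insubd x (fracmx (val x + val y)).

Definition box_inv (R : realType) (m N : nat) (V : 'M[R]_(m, N))
    (x : box_fset V) : box_fset V :=
  insubd x (fracmx (- val x)).

Lemma val_box_inv (R : realType) (m N : nat) (V : 'M[R]_(m, N))
    (x : box_fset V) :
    V \is a mxOver Num.int -> affinely_free V ->
  val (box_inv x) = fracmx (- val x).
Proof.
move=> Vint Vfree; have [Lx _] := box_fsetP x Vfree.
rewrite val_insubd fracmx_in_box // -[- val x]add0r.
by apply: barycentric_latticeB => //; exact: barycentric_lattice0.
Qed.

Lemma val_box_mul (R : realType) (m N : nat) (V : 'M[R]_(m, N))
    (x y : box_fset V) :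
    V \is a mxOver Num.int -> affinely_free V ->
  val (box_mul x y) = fracmx (val x + val y).
Proof.
move=> Vint Vfree; have [Lx _] := box_fsetP x Vfree.
have [Ly _] := box_fsetP y Vfree.
rewrite val_insubd fracmx_in_box // -[val y]opprK -[- val y]add0r.
by do 2?apply: barycentric_latticeB => //; exact: barycentric_lattice0.
Qed.

Lemma zero_in_box (R : realType) (m N : nat) (V : 'M[R]_(m, N)) :
  V \is a mxOver Num.int -> affinely_free V -> 0 \in box_fset V.
Proof.
move=> Vint Vfree; rewrite -[0]fracmx0.
exact/fracmx_in_box/barycentric_lattice0.
Qed.

Lemma fracmx_box (R : realType) (m N : nat) (V : 'M[R]_(m, N))
    (x : box_fset V) :
  affinely_free V -> fracmx (val x) = val x.
Proof.
move=> Vfree; have [_ x01] := box_fsetP x Vfree; apply/rowP=> j; rewrite !mxE.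
by apply: frac_eq; rewrite ?x01 // subrr rpred0.
Qed.

Lemma box_mulA (R : realType) (m N : nat) (V : 'M[R]_(m, N)) :
    V \is a mxOver Num.int -> affinely_free V ->
  associative (@box_mul R m N V).
Proof.
move=> Vint Vfree x y z; apply: val_inj; rewrite /= !val_box_mul //.
by rewrite [in LHS]addrC !fracmxDl [in LHS]addrC addrA.
Qed.

Lemma box_mul0 (R : realType) (m N : nat) (V : 'M[R]_(m, N))
    (Vint : V \is a mxOver Num.int) (Vfree : affinely_free V) :
  left_id (FSetSub (zero_in_box Vint Vfree)) (@box_mul R m N V).
Proof.
by move=> x; apply: val_inj; rewrite /= val_box_mul //= add0r fracmx_box.
Qed.

Lemma box_mulV (R : realType) (m N : nat) (V : 'M[R]_(m, N))
    (Vint : V \is a mxOver Num.int) (Vfree : affinely_free V) :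
  left_inverse (FSetSub (zero_in_box Vint Vfree)) (@box_inv R m N V)
    (@box_mul R m N V).
Proof.
move=> x; apply: val_inj; rewrite /= val_box_mul // val_box_inv //.
by rewrite fracmxDl addNr fracmx0.
Qed.

Lemma height_mul (R : realType) (m N : nat) (V : 'M[R]_(m, N))
    (x y : box_fset V) :
    V \is a mxOver Num.int -> affinely_free V ->
  (height (box_mul x y) <= height x + height y)%N.
Proof.
move=> Vint Vfree; rewrite -(ler_nat R) natrD !heightE // -big_split /=.
apply: ler_sum => i _.
by rewrite val_box_mul // !mxE frac_le // addr_ge0 // box_ge0.
Qed.

Lemma height_inv (R : realType) (m N : nat) (V : 'M[R]_(m, N))
    (x : box_fset V) :
    V \is a mxOver Num.int -> affinely_free V ->
  (height x + height (box_inv x))%N = #|[set i | val x 0 i != 0]|.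
Proof.
move=> Vint Vfree; apply/eqP.
rewrite -(eqr_nat R) natrD !heightE // -big_split /=; apply/eqP.
rewrite -sum1_card natr_sum [RHS]big_mkcond; apply: eq_bigr => i _.
rewrite val_box_inv // !mxE fracN; last by have [_ ->] := box_fsetP x Vfree.
by rewrite inE; case: eqP.
Qed.

(** The elements whose [j]-th coordinate vanishes form a subgroup [K j], which
is trivial or everything because the order is prime.  Hence all nontrivial
elements have the same support, and its size [s] is the constant value of
[height x + height x^-1]. *)
Lemma box_ranked (R : realType) (m N : nat) (V : 'M[R]_(m, N))
    (i : nat -> nat) :
    V \is a mxOver Num.int -> affinely_free V ->
    prime #|{: box_fset V}| ->
    (forall k j, (1 <= k < #|{: box_fset V}|)%N ->
       (i k <= j)%N = (k < #|sublevel (@height R m N V) j|)%N) ->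
  exists2 s, (s <= m)%N &
    (forall k, (1 <= k < #|{: box_fset V}|)%N ->
       (i k + i (#|{: box_fset V}| - k) = s)%N) /\
    (forall k l, (1 <= k)%N -> (1 <= l)%N -> (k + l < #|{: box_fset V}|)%N ->
       (i (k + l) <= i k + i l)%N).
Proof.
move=> Vint Vfree prT iE.
pose gT : finGroupType :=
  HB.pack (box_fset V)
    (Finite_isGroup.Build (box_fset V) (box_mulA Vint Vfree)
       (box_mul0 Vint Vfree) (box_mulV Vint Vfree)).
pose K (j : 'I_m) : {set gT} := [set x : gT | val (x : box_fset V) 0 j == 0].
have gK j : group_set (K j).
  apply/group_setP; split=> [|x y]; first by rewrite inE mxE.
  rewrite !inE => /eqP x0 /eqP y0.
  by rewrite val_box_mul // !mxE x0 y0 addr0 frac0.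
pose s := #|[set j | K j != setT]|; exists s.
  by rewrite -[X in (_ <= X)%N]card_ord max_card.
have htV (x : gT) :
    x != 1%g -> (height (x : box_fset V) + height (x^-1%g : box_fset V))%N = s.
  move=> x1; rewrite [LHS]height_inv //; apply: eq_card => j; rewrite !inE.
  congr (~~ _); apply/idP/eqP => [xj | KjT].
    by apply: (@prime_group_full gT (Group (gK j)) x prT x1); rewrite inE.
  have : x \in K j by rewrite KjT inE.
  by rewrite inE.
have ht1 : height (1%g : gT) = 0%N.
  by apply/eqP; rewrite -(eqr_nat R) heightE // big1 // => j _; rewrite mxE.
have htM (x y : gT) :
    (height ((x * y)%g : box_fset V) <=
       height (x : box_fset V) + height (y : box_fset V))%N.
  exact: height_mul.
split=> [k kp | k l k1 l1 klp].
  exact: (@ranked_reflect gT (@height R m N V) s i ht1 htV iE k kp).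
exact: (@ranked_subadditive gT (@height R m N V) i prT ht1 htM iE k l).
Qed.

(** * Simplices and their vertices *)

Definition vertex_mx (R : realType) (m N : nat) (v : 'I_m -> 'rV[R]_N) :
  'M[R]_(m, N) := \matrix_i v i.

Lemma mul_vertex_mx (R : realType) (m N : nat) (v : 'I_m -> 'rV[R]_N) c :
  c *m vertex_mx v = \sum_i c 0 i *: v i.
Proof. by rewrite mulmx_sum_row; apply: eq_bigr => i _; rewrite rowK. Qed.

Lemma vertex_mx_free (R : realType) (m N : nat) (v : 'I_m -> 'rV[R]_N) :
  affinely_independent v -> affinely_free (vertex_mx v).
Proof.
move=> vind c c1; rewrite mul_vertex_mx => cv; apply/rowP=> j.
by rewrite mxE; apply: vind c1 cv j.
Qed.

Lemma vertex_mx_int (R : realType) (m N : nat) (v : 'I_m -> 'rV[R]_N) :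
  (forall i, v i \is a mxOver Num.int) -> vertex_mx v \is a mxOver Num.int.
Proof.
by move=> vint; apply/mxOverP=> i j; rewrite mxE; have /mxOverP := vint i; apply.
Qed.

(** If [v_i] lies between two points of the simplex, then comparing barycentric
coordinates, which are nonnegative, shows that both points have zero
coordinates off [i]. *)
Lemma vertex_convex_hull (R : realType) (m N : nat) (v : 'I_m -> 'rV[R]_N) :
  affinely_independent v -> forall i, vertex (convex_hull v) (v i).
Proof.
move=> vind i; split.
  exists (fun j => (j == i)%:R); split=> [j||]; first exact: ler0n.
    by rewrite (bigD1 i) //= eqxx big1 ?addr0 // => j /negPf->.
  rewrite (bigD1 i) //= eqxx scale1r big1 ?addr0 // => j /negPf->.
  by rewrite scale0r.
move=> y z t [a [a0 a1 ->]] [b [b0 b1 ->]] /andP[t0 t1] vE.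
have cE j : (j == i)%:R - ((1 - t) * a j + t * b j) = 0.
  apply: (vind (fun j => (j == i)%:R - ((1 - t) * a j + t * b j))).
    rewrite sumrB big_split /= -!mulr_sumr a1 b1 !mulr1 subrK.
    by rewrite (bigD1 i) //= eqxx big1 ?addr0 ?subrr // => k /negPf->.
  under eq_bigr do rewrite scalerBl scalerDl -!scalerA.
  rewrite sumrB big_split /= -!scaler_sumr -vE.
  rewrite (bigD1 i) //= eqxx scale1r big1 ?addr0 ?subrr // => k /negPf->.
  by rewrite scale0r.
have zero j : j != i -> a j = 0 /\ b j = 0.
  move=> /negPf ji; have /eqP := cE j; rewrite ji sub0r oppr_eq0.
  have t1' : 0 <= 1 - t by rewrite subr_ge0 ltW.
  rewrite paddr_eq0 ?(mulr_ge0 (ltW t0)) ?mulr_ge0 // !mulf_eq0 subr_eq0.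
  by rewrite (gt_eqF t0) (gt_eqF t1) /= => /andP[/eqP ? /eqP ?].
have one (c : 'I_m -> R) : \sum_j c j = 1 -> (forall j, j != i -> c j = 0) ->
    c i = 1.
  by move=> + c0; rewrite (bigD1 i) //= big1 ?addr0.
apply: eq_bigr => j _; congr (_ *: _); have [->|ji] := eqVneq j i.
  by rewrite !one // => k /zero[].
by have [-> ->] := zero j ji.
Qed.

(** * Lattice points of dilates *)

(** The barycentric coordinates that have the box element [u.1] as fractional
part and [u.2] as integral part. *)
Definition coords (R : realType) (m N M : nat) (V : 'M[R]_(m, N))
    (u : box_fset V * {ffun 'I_m -> 'I_M.+1}) : 'rV[R]_m :=
  val u.1 + \row_i (u.2 i)%:R.

Lemma coords_sum (R : realType) (m N M : nat) (V : 'M[R]_(m, N))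
    (u : box_fset V * {ffun 'I_m -> 'I_M.+1}) :
    affinely_free V ->
  \sum_i coords u 0 i = (height u.1 + \sum_i u.2 i)%:R.
Proof.
move=> Vfree; rewrite natrD heightE // natr_sum -big_split /=.
by apply: eq_bigr => i _; rewrite !mxE.
Qed.

Lemma coords_ge0 (R : realType) (m N M : nat) (V : 'M[R]_(m, N))
    (u : box_fset V * {ffun 'I_m -> 'I_M.+1}) :
  affinely_free V -> forall i, 0 <= coords u 0 i.
Proof. by move=> Vfree i; rewrite !mxE addr_ge0 ?ler0n // box_ge0. Qed.

Lemma coords_inj (R : realType) (m N M : nat) (V : 'M[R]_(m, N)) :
  affinely_free V -> injective (@coords R m N M V).
Proof.
move=> Vfree [x f] [y g] /rowP /= E.
have xy : x = y.
  apply: val_inj; apply/rowP=> i.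
  have [_ /(_ i) x01] := box_fsetP x Vfree.
  have [_ /(_ i) y01] := box_fsetP y Vfree; have := E i; rewrite !mxE => Ei.
  rewrite -(frac_eq x01 (x := val x 0 i + (f i)%:R)).
    by apply: frac_eq => //; rewrite Ei addrAC subrr add0r natr_int.
  by rewrite addrAC subrr add0r natr_int.
congr (_, _) => //; apply/ffunP=> i; apply: val_inj => /=.
by have := E i; rewrite !mxE xy => /addrI /eqP; rewrite eqr_nat => /eqP.
Qed.

(** Integral parts of coordinates are at most [n], so any bound [M >= n] on
them loses no lattice point. *)
Lemma dilate_points (R : realType) (m N n M : nat) (v : 'I_m -> 'rV[R]_N) :
    (forall i, v i \is a mxOver Num.int) -> affinely_independent v ->
    (0 < n <= M)%N ->
  (dilate n (convex_hull v) `&` @integer_points R N)%classic =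
  [set coords u *m vertex_mx v | u in
    [set u : box_fset (vertex_mx v) * {ffun 'I_m -> 'I_M.+1} |
      (height u.1 + \sum_i u.2 i == n)%N]]%classic.
Proof.
move=> vint vind /andP[n0 nM]; have Vfree := vertex_mx_free vind.
have Vint := vertex_mx_int vint.
apply/seteqP; split=> [_ [[_ [a [a0 a1 ->]] <-]] xint|x [u /= un <-]].
  pose c := \row_i (n%:R * a i).
  have cge i : 0 <= c 0 i by rewrite mxE mulr_ge0 ?ler0n.
  have csum : \sum_i c 0 i = n%:R.
    by under eq_bigr do rewrite mxE; rewrite -mulr_sumr a1 mulr1.
  have cV : c *m vertex_mx v = n%:R *: (\sum_i a i *: v i).
    rewrite mul_vertex_mx scaler_sumr; apply: eq_bigr => i _.
    by rewrite mxE scalerA.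
  have cL : barycentric_lattice (vertex_mx v) c.
    by split; [rewrite csum natr_int | rewrite cV].
  have cle (i : 'I_m) : (Num.truncn (c 0%R i) < M.+1)%N.
    rewrite truncn_lt_nat ?cge // (@le_lt_trans _ _ n%:R) ?ltr_nat //.
    by rewrite -csum (bigD1 i) //= lerDl sumr_ge0.
  pose u : box_fset (vertex_mx v) * {ffun 'I_m -> 'I_M.+1} :=
    (FSetSub (fracmx_in_box Vint Vfree cL), [ffun i => Ordinal (cle i)]).
  have uE : coords u = c.
    apply/rowP=> i; rewrite !mxE ffunE /=.
    by have := cge i; rewrite mxE => /frac_truncn.
  exists u; last by rewrite uE cV.
  have : (height u.1 + \sum_i u.2 i)%:R == n%:R :> R.
    by rewrite -coords_sum // uE csum.
  by rewrite eqr_nat.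
have csum : \sum_i coords u 0 i = n%:R by rewrite coords_sum // (eqP un).
have nR : n%:R != 0 :> R by rewrite pnatr_eq0 -lt0n.
split.
  exists (\sum_i (coords u 0 i / n%:R) *: v i).
    exists (fun i => coords u 0 i / n%:R); split=> // [i|].
      by rewrite divr_ge0 ?ler0n ?coords_ge0.
    by rewrite -mulr_suml csum divff.
  rewrite mul_vertex_mx scaler_sumr; apply: eq_bigr => i _.
  by rewrite scalerA mulrCA divff ?mulr1.
have [[_ +] _] := box_fsetP u.1 Vfree.
rewrite /integer_points /= mulmxDl => xV.
have rV : (\row_i (u.2 i)%:R : 'rV[R]_m) *m vertex_mx v \is a mxOver Num.int.
  by rewrite mxOverM //; apply/mxOverP=> i j; rewrite mxE natr_int.
by apply/mxOverP=> i j; rewrite mxE rpredD ?(mxOverP xV) ?(mxOverP rV).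
Qed.

Lemma ehrhartE (R : realType) (m N n M : nat) (v : 'I_m -> 'rV[R]_N) :
    (forall i, v i \is a mxOver Num.int) -> affinely_independent v ->
    (n <= M)%N ->
  ehrhart (convex_hull v) n =
  #|[set u : box_fset (vertex_mx v) * {ffun 'I_m -> 'I_M.+1} |
       (height u.1 + \sum_i u.2 i == n)%N]|.
Proof.
move=> vint vind nM; have Vfree := vertex_mx_free vind.
have Vint := vertex_mx_int vint; rewrite /ehrhart.
have [->|n0] := eqVneq n 0%N.
  (* Only the zero vector has nonnegative coordinates of sum 0. *)
  pose u0 : box_fset (vertex_mx v) * {ffun 'I_m -> 'I_M.+1} :=
    (FSetSub (zero_in_box Vint Vfree), [ffun=> ord0]).
  have u00 : coords u0 = 0 by apply/rowP=> i; rewrite !mxE ffunE addr0.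
  apply/esym; apply: (@eq_card1 _ u0) => u; rewrite !inE.
  rewrite -(inj_eq (@coords_inj _ _ _ M _ Vfree)) u00.
  rewrite -(eqr_nat R) -coords_sum //.
  apply/eqP/eqP => [u_0|->]; last by rewrite big1 // => i _; rewrite mxE.
  apply/rowP=> i; rewrite [RHS]mxE; move/eqP: u_0.
  rewrite psumr_eq0 => [/allP/(_ i (mem_index_enum _))/eqP //|j _].
  exact: coords_ge0.
rewrite (@dilate_points _ _ _ n M) ?lt0n ?n0 //.
set A := [set u | _]%classic.
have Afin : finite_set A by exact: finite_finset.
rewrite fset_set_image // card_in_imfset /=; last first.
  move=> u w; rewrite !in_fset_set // => /set_mem/eqP un /set_mem/eqP wn uw.
  apply: (@coords_inj _ _ _ M _ Vfree); apply/eqP; rewrite -subr_eq0; apply/eqP.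
  apply: (Vfree); last by rewrite mulmxBl uw subrr.
  under eq_bigr do rewrite mxE [(- coords w) _ _]mxE.
  by rewrite sumrB !coords_sum // un wn subrr.
rewrite cardE; apply: perm_size; apply: uniq_perm => [||u].
- exact: fset_uniq.
- exact: enum_uniq.
rewrite mem_enum in_fset_set // [RHS]inE.
by apply/idP/idP => [/set_mem|/(@mem_set _ A)].
Qed.

(** * The delta-polynomial *)

(** Expanding the power of the geometric sum makes its terms the vectors of
exponents, one exponent for each factor. *)
Lemma coef_count (T : finType) (ht : T -> nat) (m M n : nat) :
  ((\sum_x 'X^(ht x)) * (\sum_(k < M.+1) 'X^k) ^+ m : {poly int})`_n
  = #|[set u : T * {ffun 'I_m -> 'I_M.+1} |
         (ht u.1 + \sum_i u.2 i == n)%N]|%:Z.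
Proof.
rewrite -[m in LHS]card_ord -prodr_const bigA_distr_bigA /=.
rewrite big_distrlr /= pair_bigA /= coef_sum.
rewrite -sum1_card -natz natr_sum [RHS]big_mkcond; apply: eq_bigr => u _.
by rewrite prodrXr -exprD coefXn inE eq_sym; case: eqP.
Qed.

(** Up to degree [j], the series [1 / (1 - 'X)] may be replaced by its
truncation [1 + 'X + ... + 'X^j], whose product with [1 - 'X] is
[1 - 'X^(j.+1)]. *)
Lemma series_mul_geometric (d : nat) (f : nat -> int) (h : {poly int}) j :
    (forall n, (n <= j)%N ->
       f n = (h * (\sum_(k < j.+1) 'X^k) ^+ d.+1)`_n) ->
  series_mul (fun k => ((1 - 'X : {poly int}) ^+ d.+1)`_k) f j = h`_j.
Proof.
move=> fE; rewrite /series_mul.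
under eq_bigr do rewrite fE ?leq_subr //.
rewrite -coefM mulrCA -exprMn.
have -> : (1 - 'X) * (\sum_(k < j.+1) 'X^k) = 1 - 'X^(j.+1) :> {poly int}.
  by rewrite -[RHS]opprB (subrX1 ('X : {poly int})) -mulNr opprB.
have [q ->] : exists q : {poly int},
    (1 - 'X^(j.+1)) ^+ d.+1 = 1 + 'X^(j.+1) * q.
  exists (- \sum_(k < d.+1) (1 - 'X^(j.+1)) ^+ k).
  apply/eqP; rewrite [X in _ == X]addrC -subr_eq.
  rewrite (subrX1 (1 - 'X^(j.+1) : {poly int})) [X in X * _]addrC addKr.
  by rewrite mulrN mulNr.
by rewrite mulrDr mulr1 coefD mulrCA coefXnM ltnSn addr0.
Qed.

(** By [coef_count] and [ehrhartE], the Ehrhart numbers up to any order are the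
coefficients of the height polynomial times a power of a truncated geometric
series, which [series_mul_geometric] cancels. *)
Lemma delta_poly_height (R : realType) (N d : nat) (v : 'I_d.+1 -> 'rV[R]_N) :
    (forall i, v i \is a mxOver Num.int) -> affinely_independent v ->
  delta_poly d (convex_hull v)
  = \sum_(x : box_fset (vertex_mx v)) 'X^(height x).
Proof.
move=> vint vind; set H := RHS.
have dE j : delta d (convex_hull v) j = H`_j.
  apply: series_mul_geometric => n nj.
  by rewrite coef_count; congr Posz; apply: ehrhartE.
rewrite /delta_poly; under eq_bigr do rewrite dE.
rewrite -poly_def; apply/polyP=> j; rewrite coef_poly; case: ltnP => // dj.
rewrite coef_sum big1 // => x _; rewrite coefXn.
have := height_lt x (vertex_mx_free vind).
by case: eqP => // <-; rewrite ltnNge dj.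
Qed.

Lemma normalized_volumeE (R : realType) (N d : nat) (P : set 'rV[R]_N) :
  normalized_volume d P = (delta_poly d P).[1].
Proof.
rewrite /normalized_volume /delta_poly horner_sum; apply: eq_bigr => j _.
by rewrite hornerZ hornerXn expr1n mulr1.
Qed.

(** * Heights of a simplex of prime normalized volume *)

Theorem theorem0p1 (R : realType) (N d p : nat) (P : set 'rV[R]_N)
    (i : nat -> nat)
    (simplexP : integral_simplex d P)
    (volP : normalized_volume d P = p%:Z)
    (prime_p : prime p) (odd_p : odd p)
    (deltaP : delta_poly d P = 1 + \sum_(1 <= k < p) 'X^(i k))
    (i_range : forall k : nat, (1 <= k <= p - 1)%N -> (1 <= i k <= d)%N)
    (i_mono : forall k l : nat,
       (1 <= k)%N -> (k <= l)%N -> (l <= p - 1)%N -> (i k <= i l)%N) :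
  ((forall k : nat, (1 <= k <= (p - 1) %/ 2)%N ->
      (i k + i (p - k) = i 1 + i (p - 1))%N)
   /\ (i 1 + i (p - 1) <= d + 1)%N)
  /\ (forall k l : nat, (1 <= k)%N -> (k <= l)%N -> (l <= p - 1)%N ->
        (k + l <= p - 1)%N -> (i k + i l >= i (k + l))%N).
Proof.
case: simplexP => -[_ vertex_int] [v [vind PE]].
have vint j : v j \is a mxOver Num.int.
  by apply: vertex_int; rewrite PE; apply: vertex_convex_hull.
have Vfree := vertex_mx_free vind; have Vint := vertex_mx_int vint.
pose T := box_fset (vertex_mx v).
have deltaE : delta_poly d P = \sum_(x : T) 'X^(height x).
  by rewrite PE delta_poly_height.
have cardT : #|{: T}| = p.
  apply/eqP; rewrite -eqz_nat -volP normalized_volumeE deltaE horner_sum.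
  under eq_bigr do rewrite hornerXn expr1n.
  by rewrite -natz sumr_const.
have p_gt1 := prime_gt1 prime_p.
have iE k j : (1 <= k < #|{: T}|)%N ->
    (i k <= j)%N = (k < #|sublevel (fun x : T => height x) j|)%N.
  rewrite cardT; move: k j; apply: sorted_rank => // j.
  by apply: card_sublevel; rewrite -deltaE.
have [] := box_ranked Vint Vfree _ iE; first by rewrite cardT.
rewrite cardT => s sd [refl_i sub_i].
have i1 : (i 1 + i (p - 1))%N = s by apply: refl_i; lia.
rewrite i1; split; [split=> [k kp|]|move=> k l k1 kl lp klp].
- by apply: refl_i; lia.
- by rewrite addn1.
- by apply: sub_i; lia.
Qed.
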